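(* Suppose that the algebra $A(\xi)$ is such that $\alpha=\beta=0$ and $\nu=1$ (so $\chi_1\chi_2=\epsilon$ and $r=s$). Let $\eta\in F(\xi)$. Let $(c_i)_{i\ge0}$ be the scalars defined by $c_0=0$ and $$c_i=q\left(c_{i-1}-\nu\left((\eta\chi_1^{i-1})(g_1g_2)-1\right)\right)=q\left(c_{i-1}+\nu-\nu q^{2(i-1)}\eta(g_1g_2)\right),\qquad i>0.$$ Let $N$ be the least positive integer such that $c_N=0$ (one has $N\le r$). Let $L(\eta)$ be a vector space with basis $(v_i)_{0\le i\le N-1}$, and set $v_{-1}=v_N=0$ in $L(\eta)$. Then there exists a representation of $A(\xi)$ on $L(\eta)$ given by $$h.v_i=(\eta\chi_1^i)(h)v_i\ (h\in\Gamma),\qquad y.v_i=c_iv_{i-1},\qquad x.v_i=v_{i+1}.$$ Furthermore, $L(\eta)$ is irreducible. Also, any irreducible $A(\xi)$-module is isomorphic to $L(\eta)$ for some $\eta\in F(\xi)$; and, for $\eta,\eta'\in F(\xi)$, $L(\eta)$ is isomorphic to $L(\eta')$ only when $\eta=\eta'$.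
   Context: Let $k$ be an algebraically closed field of characteristic $0$, $\Gamma$ a finite abelian group, $\widehat{\Gamma}$ its group of characters $\Gamma\to k^\times$, with trivial character $\epsilon$. Let $g_1,g_2\in\Gamma$ and $\chi_1,\chi_2\in\widehat\Gamma$ with $\chi_1(g_2)\chi_2(g_1)=1$. Let $r>1$ be the order of $q:=\chi_1(g_1)$ and $s>1$ the order of $\chi_2(g_2)$. Let $\alpha_{11},\alpha_{22},\nu\in k$ be scalars such that: $\alpha_{11}=0$ if $g_1^r=1$ or $\chi_1^r\neq\epsilon$; $\alpha_{22}=0$ if $g_2^s=1$ or $\chi_2^s\ne\epsilon$; $\nu=0$ if $g_1g_2=1$ or $\chi_1\chi_2\neq\epsilon$. The lifting $A$ of the quantum plane is the pointed Hopf algebra (of dimension $|\Gamma|rs$) generated by the elements $h\in\Gamma$ (with the relations of the group $\Gamma$) and $x,y$, with relations $hx=\chi_1(h)xh$, $hy=\chi_2(h)yh$ ($h\in\Gamma$), $x^r=\alpha_{11}(g_1^r-1)$, $y^s=\alpha_{22}(g_2^s-1)$, $xy=\chi_2(g_1)yx+\nu(g_1g_2-1)$. Let $\Lambda=\{g\in\Gamma:\chi_1(g)=\chi_2(g)=1\}$, a subgroup of $\Gamma$ that is central in $A$. If $\alpha_{11}\ne0$ then $g_1^r\in\Lambda$, and if $\alpha_{22}\neq 0$ then $g_2^s\in\Lambda$. Fix $\xi\in\widehat\Lambda$ and put $\alpha=\alpha_{11}(\xi(g_1^r)-1)$ and $\beta=\alpha_{22}(\xi(g_2^s)-1)$ (understood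 to be $0$ when $\alpha_{11}=0$, resp. $\alpha_{22}=0$). The algebra $A(\xi)$ is the quotient of $A$ by the relations $g=\xi(g)1$ for $g\in\Lambda$; that is, it is generated by $x$, $y$ and $h\in\Gamma$ with the relations of $\Gamma$ and $g=\xi(g)$ ($g\in\Lambda$), $hx=\chi_1(h)xh$, $hy=\chi_2(h)yh$ ($h\in\Gamma$), $x^r=\alpha$, $y^s=\beta$, $xy=\chi_2(g_1)yx+\nu(g_1g_2-1)$. Let $F(\xi)=\{\eta\in\widehat\Gamma:\eta|_\Lambda=\xi\}$. When $\chi_1\chi_2=\epsilon$ one has $q=\chi_1(g_1)=\chi_1(g_2)=\chi_2(g_1)^{-1}=\chi_2(g_2)^{-1}$, hence $r=s$. *)

(* Defs.v *)
From HB Require Import structures.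
From mathcomp Require Import all_boot all_fingroup all_algebra.
From mathcomp Require Import ring_quotient.
From mathcomp Require Import boolp.
From mathcomp Require Import monalg.

Set Implicit Arguments.
Unset Strict Implicit.
Unset Printing Implicit Defensive.

Import GRing.Theory.

Local Open Scope ring_scope.
Local Open Scope quotient_scope.

Section TwoSidedQuotient.
Variables (k : comNzRingType) (B : algType k) (R : B -> Prop).

Definition two_sided_ideal (J : {pred B}) : Prop :=
  [/\ zmod_closed J, (forall a b, b \in J -> a * b \in J)
    & (forall a b, a \in J -> a * b \in J)].

Definition ideal_gen : {pred B} := fun a =>
  `[< forall J : {pred B}, two_sided_ideal J -> (forall b, R b -> b \in J) ->
      a \in J >].

Lemma ideal_genP a :
  a \in ideal_gen <->
  forall J : {pred B}, two_sided_ideal J -> (forall b, R b -> b \in J) ->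
    a \in J.
Proof. by split=> [/asboolP|h]; last apply/asboolP. Qed.

Lemma ideal_gen_ideal : two_sided_ideal ideal_gen.
Proof.
split; first split.
- by apply/ideal_genP => J [[]].
- move=> a b /ideal_genP ha /ideal_genP hb; apply/ideal_genP => J hJ hR.
  by case: (hJ) => -[_ hB] _ _; apply: hB; [apply: ha|apply: hb].
- move=> a b /ideal_genP hb; apply/ideal_genP => J hJ hR.
  by case: (hJ) => _ hl _; apply/hl/hb.
- move=> a b /ideal_genP ha; apply/ideal_genP => J hJ hR.
  by case: (hJ) => _ _ hr; apply/hr/ha.
Qed.

Lemma mem_ideal_gen a : R a -> a \in ideal_gen.
Proof. by move=> Ra; apply/ideal_genP => J _; apply. Qed.

Fact ideal_gen_zmod_closed : zmod_closed ideal_gen.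
Proof. by case: ideal_gen_ideal. Qed.
HB.instance Definition _ :=
  GRing.isZmodClosed.Build B ideal_gen ideal_gen_zmod_closed.

Lemma ideal_genMl a b : b \in ideal_gen -> a * b \in ideal_gen.
Proof. by case: ideal_gen_ideal => _ + _; apply. Qed.

Lemma ideal_genMr a b : a \in ideal_gen -> a * b \in ideal_gen.
Proof. by case: ideal_gen_ideal => _ _; apply. Qed.

Definition quot_alg : Type := Quotient.quot ideal_gen.
HB.instance Definition _ := GRing.Zmodule.on quot_alg.

Definition quot_pi (a : B) : quot_alg := \pi_(Quotient.quot ideal_gen) a.
Let rp (u : quot_alg) : B := generic_quotient.repr (u : Quotient.quot ideal_gen).

Let quot_piK u : quot_pi (rp u) = u.
Proof. exact: generic_quotient.reprK. Qed.

Lemma quot_piP a b : (quot_pi a = quot_pi b) <-> (a - b \in ideal_gen).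
Proof. by rewrite Quotient.idealrBE; split=> [/eqP|/eqP]. Qed.

Lemma quot_piB : {morph quot_pi : a b / a - b}.
Proof. exact: (raddfB \pi_(Quotient.quot ideal_gen)). Qed.
HB.instance Definition _ := GRing.isZmodMorphism.Build B quot_alg quot_pi quot_piB.

Definition quot_one : quot_alg := quot_pi 1.
Definition quot_mul (u v : quot_alg) : quot_alg := quot_pi (rp u * rp v).
Definition quot_scale (c : k) (u : quot_alg) : quot_alg := quot_pi (c *: rp u).

Let rp_pi a : rp (quot_pi a) - a \in ideal_gen.
Proof. by apply/quot_piP; rewrite quot_piK. Qed.

Let quot_mulE a b : quot_mul (quot_pi a) (quot_pi b) = quot_pi (a * b).
Proof.
apply/quot_piP.
have -> : rp (quot_pi a) * rp (quot_pi b) - a * b =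
  (rp (quot_pi a) - a) * rp (quot_pi b) + a * (rp (quot_pi b) - b).
  by rewrite mulrBl mulrBr addrA subrK.
by apply: rpredD; [apply: ideal_genMr|apply: ideal_genMl]; apply: rp_pi.
Qed.

Let quot_scaleE c a : quot_scale c (quot_pi a) = quot_pi (c *: a).
Proof.
apply/quot_piP; rewrite -scalerBr -[X in c *: X]mul1r scalerAl.
exact: ideal_genMl (rp_pi _).
Qed.

Let quotW (P : quot_alg -> Prop) : (forall a, P (quot_pi a)) -> forall u, P u.
Proof. by move=> h u; have := h (rp u); rewrite quot_piK. Qed.

Fact quot_mulA : associative quot_mul.
Proof. by elim/quotW=> a; elim/quotW=> b; elim/quotW=> c; rewrite !quot_mulE mulrA. Qed.
Fact quot_mul1l : left_id quot_one quot_mul.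
Proof. by elim/quotW=> a; rewrite quot_mulE mul1r. Qed.
Fact quot_mul1r : right_id quot_one quot_mul.
Proof. by elim/quotW=> a; rewrite quot_mulE mulr1. Qed.
Fact quot_mulDl : left_distributive quot_mul +%R.
Proof.
elim/quotW=> a; elim/quotW=> b; elim/quotW=> c.
by rewrite -raddfD !quot_mulE mulrDl raddfD.
Qed.
Fact quot_mulDr : right_distributive quot_mul +%R.
Proof.
elim/quotW=> a; elim/quotW=> b; elim/quotW=> c.
by rewrite -raddfD !quot_mulE mulrDr raddfD.
Qed.

(* Only a pzRingType: the quotient is trivial when the relations imply 1 = 0.
   The library has algebras over nonzero rings only, whence the separate
   lmodType structure and the two compatibility lemmas below. *)
HB.instance Definition _ := GRing.Zmodule_isPzRing.Build quot_alg
  quot_mulA quot_mul1l quot_mul1r quot_mulDl quot_mulDr.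

Fact quot_scaleA c d u : quot_scale c (quot_scale d u) = quot_scale (c * d) u.
Proof. by elim/quotW: u => a; rewrite !quot_scaleE scalerA. Qed.
Fact quot_scale1 : left_id 1 quot_scale.
Proof. by elim/quotW=> a; rewrite quot_scaleE scale1r. Qed.
Fact quot_scaleDr : right_distributive quot_scale +%R.
Proof.
move=> c; elim/quotW=> a; elim/quotW=> b.
by rewrite -raddfD !quot_scaleE scalerDr raddfD.
Qed.
Fact quot_scaleDl u : {morph quot_scale^~ u : c d / c + d}.
Proof. by move=> c d; elim/quotW: u => a; rewrite !quot_scaleE scalerDl raddfD. Qed.

HB.instance Definition _ := GRing.Zmodule_isLmodule.Build k quot_alg
  quot_scaleA quot_scale1 quot_scaleDr quot_scaleDl.

Lemma quot_piM : {morph quot_pi : a b / a * b}.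
Proof. by move=> a b; rewrite -quot_mulE. Qed.
Lemma quot_pi1 : quot_pi 1 = 1.
Proof. by []. Qed.
Lemma quot_piZ c a : quot_pi (c *: a) = c *: quot_pi a.
Proof. by rewrite -quot_scaleE. Qed.

Lemma quot_scalerAl c (u v : quot_alg) : c *: (u * v) = (c *: u) * v.
Proof.
elim/quotW: u => a; elim/quotW: v => b.
by rewrite -quot_piM -!quot_piZ -quot_piM scalerAl.
Qed.
Lemma quot_scalerAr c (u v : quot_alg) : c *: (u * v) = u * (c *: v).
Proof.
elim/quotW: u => a; elim/quotW: v => b.
by rewrite -quot_piM -!quot_piZ -quot_piM scalerAr.
Qed.

Lemma quot_pi_surj u : exists a, u = quot_pi a.
Proof. by exists (rp u). Qed.

Lemma quot_pi_rel a : R a -> quot_pi a = 0.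
Proof.
move=> Ra; rewrite -(raddf0 quot_pi); apply/quot_piP.
by rewrite subr0 mem_ideal_gen.
Qed.

End TwoSidedQuotient.

Section Representations.
Variables (k : comNzRingType) (B : algType k) (R : B -> Prop).

Record representation (V : lmodType k) := Representation {
  rep_act :> quot_alg R -> V -> V;
  rep_act_linear : forall a, linear (rep_act a);
  rep_act_linearl : forall v, linear (rep_act^~ v);
  rep_act1 : forall v, rep_act 1 v = v;
  rep_actM : forall a b v, rep_act (a * b) v = rep_act a (rep_act b v) }.

Definition stable (V : lmodType k) (rho : representation V) (W : {pred V}) :=
  forall a v, v \in W -> rho a v \in W.

Definition irreducible (V : lmodType k) (rho : representation V) : Prop :=
  (exists v : V, v <> 0) /\
  forall W : {pred V}, submod_closed W -> stable rho W ->
    (forall v, v \in W -> v = 0) \/ (forall v, v \in W).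

Definition isomorphic (V1 V2 : lmodType k)
    (rho1 : representation V1) (rho2 : representation V2) : Prop :=
  exists2 f : {linear V1 -> V2}, bijective f &
    forall a v, f (rho1 a v) = rho2 a (f v).

End Representations.

Section FreeAlgebra.
Variables (k : comNzRingType) (T : choiceType).

(* Noncommutative polynomials in variables indexed by T. *)
Definition free_alg : Type := {malg k[{fmonom T}]}.
HB.instance Definition _ := GRing.Lalgebra.on free_alg.

Fact free_alg_scalerAr c (a b : free_alg) : c *: (a * b) = a * (c *: b).
Proof.
suff aC : a * (c%:MP : free_alg) = c *: a.
  by rewrite -[in RHS](mul_malgC c b) mulrA aC scalerAl.
rewrite [LHS]fgmulgU; apply: eq_bigr => m _.
by rewrite mulm1 mulrC.
Qed.
HB.instance Definition _ := GRing.Lalgebra_isAlgebra.Build k free_alg free_alg_scalerAr.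

Definition free_gen (i : T) : free_alg := << fmu i >>.

End FreeAlgebra.

Section Lifting.
Variables (k : closedFieldType) (Gam : finGroupType).

(* The values are units of k because H is a group in every use below. *)
Definition is_character (H : {set Gam}) (chi : Gam -> k) : Prop :=
  chi 1%g = 1 /\ {in H &, forall g h, chi (g * h)%g = chi g * chi h}.

Record datum := Datum {
  g1 : Gam; g2 : Gam;
  chi1 : Gam -> k; chi2 : Gam -> k;
  r : nat; s : nat;
  alpha11 : k; alpha22 : k; nu : k }.

Implicit Types (D : datum) (xi eta : Gam -> k).

Definition qpar D : k := chi1 D (g1 D).

Record lifting_datum D : Prop := {
  chi1_char : is_character [set: Gam] (chi1 D);
  chi2_char : is_character [set: Gam] (chi2 D);
  chi12_braid : chi1 D (g2 D) * chi2 D (g1 D) = 1;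
  r_gt1 : (1 < r D)%N;
  r_order : (r D).-primitive_root (qpar D);
  s_gt1 : (1 < s D)%N;
  s_order : (s D).-primitive_root (chi2 D (g2 D));
  alpha11_eq0 : (g1 D ^+ r D = 1)%g \/ ~ (forall h, chi1 D h ^+ r D = 1) ->
    alpha11 D = 0;
  alpha22_eq0 : (g2 D ^+ s D = 1)%g \/ ~ (forall h, chi2 D h ^+ s D = 1) ->
    alpha22 D = 0;
  nu_eq0 : (g1 D * g2 D = 1)%g \/ ~ (forall h, chi1 D h * chi2 D h = 1) ->
    nu D = 0 }.

Definition Lam D : {set Gam} := [set g | (chi1 D g == 1) && (chi2 D g == 1)].

(* Characters of the subgroup Lam D are functions on the whole of Gam whose
   values outside Lam D are irrelevant.  If alpha11 D != 0 then
   g1 D ^+ r D \in Lam D, so alpha never depends on an irrelevant value;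
   likewise for beta. *)
Definition alpha D xi : k := alpha11 D * (xi (g1 D ^+ r D)%g - 1).
Definition beta D xi : k := alpha22 D * (xi (g2 D ^+ s D)%g - 1).

(* Generators of A(xi): inl h is h \in Gam, inr true is x, inr false is y. *)
Definition gens : Type := (Gam + bool)%type.
HB.instance Definition _ := Choice.on gens.

Definition freeA : Type := free_alg k gens.
HB.instance Definition _ := GRing.Algebra.on freeA.

Definition fh (h : Gam) : freeA := free_gen k (inl h : gens).
Definition fx : freeA := free_gen k (inr true : gens).
Definition fy : freeA := free_gen k (inr false : gens).

(* relA D xi a: the equation a = 0 is a defining relation of A(xi). *)
Inductive relA D xi : freeA -> Prop :=
| rel_1 : relA D xi (fh 1%g - 1)
| rel_mul g h : relA D xi (fh (g * h)%g - fh g * fh h)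
| rel_Lam g : g \in Lam D -> relA D xi (fh g - (xi g)%:A)
| rel_hx h : relA D xi (fh h * fx - chi1 D h *: (fx * fh h))
| rel_hy h : relA D xi (fh h * fy - chi2 D h *: (fy * fh h))
| rel_xr : relA D xi (fx ^+ r D - (alpha D xi)%:A)
| rel_ys : relA D xi (fy ^+ s D - (beta D xi)%:A)
| rel_xy : relA D xi (fx * fy -
    (chi2 D (g1 D) *: (fy * fx) + nu D *: (fh (g1 D * g2 D)%g - 1))).

Local Notation A D xi := (quot_alg (relA D xi)).

Definition Ah D xi (h : Gam) : A D xi := quot_pi (relA D xi) (fh h).
Definition Ax D xi : A D xi := quot_pi (relA D xi) fx.
Definition Ay D xi : A D xi := quot_pi (relA D xi) fy.

Definition inF D xi eta : Prop :=
  is_character [set: Gam] eta /\ {in Lam D, eta =1 xi}.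

Fixpoint c_ D eta (i : nat) : k :=
  if i is j.+1 then
    qpar D * (c_ D eta j -
      nu D * (eta (g1 D * g2 D)%g * chi1 D (g1 D * g2 D)%g ^+ j - 1))
  else 0.

Definition least_zero D eta (N : nat) : Prop :=
  [/\ (0 < N)%N, c_ D eta N = 0 &
      forall m, (0 < m < N)%N -> c_ D eta m <> 0].

(* The default value 0 of v`_i for i >= N encodes v_N = 0. *)
Definition L_action D xi eta (N : nat) (L : vectType k) (v : N.-tuple L)
    (rho : representation (relA D xi) L) : Prop :=
  forall i : nat, (i < N)%N ->
    [/\ forall h, rho (Ah D xi h) v`_i = (eta h * chi1 D h ^+ i) *: v`_i,
        rho (Ay D xi) v`_i = c_ D eta i *: (if i is j.+1 then v`_j else 0)
      & rho (Ax D xi) v`_i = v`_i.+1].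

Definition is_L D xi eta (N : nat) (L : vectType k) (v : N.-tuple L)
    (rho : representation (relA D xi) L) : Prop :=
  [/\ least_zero D eta N, basis_of fullv v & L_action eta v rho].

End Lifting.

Arguments is_L {k Gam D xi} eta {N L} v rho.

(* Main.v *)
(* With t = eta(g_1 g_2), the scalars have the closed form
   c_n (q - 1) = (q^n - 1) (q - t q^n), so c_r = 0.
   In a combination of w_0, ..., w_{N-1}, if m is the largest index with a
   nonzero coefficient then y^m maps the combination to a nonzero multiple of
   w_0, because c_1, ..., c_{N-1} are nonzero.  Hence every nonzero
   submodule of L(eta) contains v_0, and the kernel of y is the line of v_0,
   on which Gamma acts by eta: L(eta) is irreducible and determines eta.
   Conversely, in an irreducible module y is nilpotent, and its nonzero kernel
   is stable under the commuting finite-order operators h, hence contains a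
   common eigenvector w_0.  The vectors w_i = x^i w_0 then satisfy the formulas
   defining L(eta); the span of the w_i with i >= N is a submodule since
   c_N = 0, and it is proper, so w_N = 0. *)

From HB Require Import structures.
Require Import Defs.
From mathcomp Require Import all_boot all_fingroup all_algebra.
From mathcomp Require Import finmap boolp monalg ring zify.

Set Implicit Arguments.
Unset Strict Implicit.
Unset Printing Implicit Defensive.

Import GRing.Theory.

Local Open Scope ring_scope.

(** * Modules over free algebras and their quotients *)

Lemma malgU_scale (R : nzRingType) (K : choiceType) (c : R) (m : K) :
  << c *g m >> = c *: (<< m >> : {malg R[K]}).
Proof. by apply/malgP => m'; rewrite mcoeffZ !mcoeffU mulr_natr. Qed.

Section FreeAlgebraModules.
Variables (k : comNzRingType) (T : choiceType).
Local Notation FA := (free_alg k T).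

(** Monomials span the free algebra, and each arises from 1 by multiplying by variables on the
    left. *)
Lemma free_alg_ind (P : FA -> Prop) :
  P 0 -> (forall c a b, P a -> P b -> P (c *: a + b)) ->
  P 1 -> (forall i a, P a -> P (free_gen k i * a)) ->
  forall a, P a.
Proof.
move=> P0 PD P1 Pg a.
have Pm (s : seq T) : P (<< 1 *g FMonom s >> : {malg k[{fmonom T}]}).
  elim: s => [|i s IHs].
    have -> : FMonom [::] = mone :> {fmonom T} by apply/eqP; rewrite fmP fm1.
    exact: P1.
  have -> : FMonom (i :: s) = mmul (fmu i) (FMonom s).
    by apply/eqP; rewrite fmP fmM fmU.
  by rewrite -[1](mulr1 1) -(fgmulUU 1 1); apply: Pg.
rewrite [a]monalgE; elim: (enum_fset _) => [|m r IHr]; first by rewrite big_nil.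
rewrite big_cons malgU_scale.
by apply: PD; first by case: m.
Qed.

Variables (V : lmodType k) (f : T -> {linear V -> V}).

(** The action of the free algebra in which the variable [i] acts as [f i]: a word acts as the
    composite of its letters, the leftmost one last. *)
Definition free_act (a : FA) (v : V) : V :=
  \sum_(m <- msupp a) a@_m *: foldr (fun i => f i) v m.

(** Allows several elements to be summed over one common set of monomials, as linearity in the
    algebra variable requires. *)
Lemma free_act_widen (d : {fset {fmonom T}}) a v : (msupp a `<=` d)%fset ->
  free_act a v = \sum_(m <- d) a@_m *: foldr (fun i => f i) v m.
Proof.
move=> le; rewrite [LHS](big_fset_incl _ le) => //= x xd /mcoeff_outdom ->.
by rewrite scale0r.
Qed.

Lemma free_act_linearl v : linear (free_act^~ v).
Proof.
move=> c a b.
rewrite !(@free_act_widen (msupp a `|` (msupp b `|` msupp (c *: a + b)))%fset).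
- rewrite scaler_sumr -big_split /=; apply: eq_bigr => m _.
  by rewrite mcoeffD mcoeffZ scalerDl scalerA.
- by apply/fsubsetP => x; rewrite !inE => ->; rewrite ?orbT.
- by apply/fsubsetP => x; rewrite !inE => ->; rewrite ?orbT.
- by apply/fsubsetP => x; rewrite !inE => ->; rewrite ?orbT.
Qed.

Lemma free_act_linear a : linear (free_act a).
Proof.
move=> c u v; rewrite /free_act scaler_sumr -big_split /=; apply: eq_bigr => m _.
rewrite scalerA mulrC -scalerA -scalerDr; congr (_ *: _).
by elim: (m : seq T) => //= i s ->; rewrite linearP.
Qed.

HB.instance Definition _ a :=
  GRing.isLinear.Build k V V *:%R (free_act a) (free_act_linear a).

Lemma free_act0l v : free_act 0 v = 0.
Proof. by rewrite /free_act msupp0 big_seq_fset0. Qed.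

Lemma free_actU (m : {fmonom T}) v :
  free_act (<< m >> : {malg k[{fmonom T}]}) v = foldr (fun i => f i) v m.
Proof.
by rewrite (free_act_widen _ (@msuppU_le _ _ _ _)) big_seq_fset1 mcoeffUU scale1r.
Qed.

Lemma free_act1 v : free_act 1 v = v.
Proof. by rewrite free_actU fm1. Qed.

Lemma free_act_gen i v : free_act (free_gen k i) v = f i v.
Proof. by rewrite free_actU fmU. Qed.

Lemma free_actZl c a v : free_act (c *: a) v = c *: free_act a v.
Proof. by have := free_act_linearl v c a 0; rewrite /= addr0 free_act0l addr0. Qed.

Lemma free_actDl a b v : free_act (a + b) v = free_act a v + free_act b v.
Proof. by have := free_act_linearl v 1 a b; rewrite /= !scale1r. Qed.

Lemma free_actBl a b v : free_act (a - b) v = free_act a v - free_act b v.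
Proof. by rewrite free_actDl -[- b]scaleN1r free_actZl scaleN1r. Qed.

(** Multiplying by a variable prepends one letter to every word, hence one more application of
    [f i]; this is the inductive step of [free_actM]. *)
Lemma free_act_genM i a v : free_act (free_gen k i * a) v = f i (free_act a v).
Proof.
rewrite [in LHS](monalgE a) mulr_sumr [in RHS]/free_act linear_sum /=.
elim: (enum_fset _) => [|m r IHr]; first by rewrite !big_nil free_act0l.
rewrite !big_cons free_actDl IHr linearZ; congr (_ + _).
rewrite [X in free_act X]fgmulUU mul1r malgU_scale.
by rewrite free_actZl free_actU fmM fmU.
Qed.

Lemma free_actM a b v : free_act (a * b) v = free_act a (free_act b v).
Proof.
elim/free_alg_ind: a => [|c a a' IHa IHa'||i a IHa].
- by rewrite mul0r !free_act0l.
- have -> : (c *: a + a') * b = c *: (a * b) + a' * b by rewrite mulrDl scalerAl.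
  apply: etrans (free_act_linearl v c (a * b) (a' * b)) _.
  apply: etrans (congr2 (fun u w => c *: u + w) IHa IHa') _.
  exact/esym/(free_act_linearl (free_act b v) c a a').
- by rewrite mul1r free_act1.
- have -> : free_gen k i * a * b = free_gen k i * (a * b) by rewrite mulrA.
  apply: etrans (free_act_genM i (a * b) v) _; apply: etrans (congr1 (f i) IHa) _.
  exact/esym/(free_act_genM i a (free_act b v)).
Qed.

Variable R : FA -> Prop.
Hypothesis f_rel : forall a, R a -> forall v, free_act a v = 0.

(** The annihilator of [V] is a two-sided ideal containing [R], so it contains the ideal generated
    by [R]. *)
Lemma free_act_ideal_gen a v : a \in ideal_gen R -> free_act a v = 0.
Proof.
move=> /ideal_genP/(_ (fun b => `[< forall v, free_act b v = 0 >])) aP.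
suff /asboolP : `[< forall v, free_act a v = 0 >] by [].
apply: aP => [|b /f_rel Rb]; last exact/asboolP.
split; first split.
- by apply/asboolP => w; rewrite free_act0l.
- move=> b c /asboolP hb /asboolP hc; apply/asboolP => w.
  by rewrite free_actBl hb hc subrr.
- move=> b c /asboolP hc; apply/asboolP => w.
  by rewrite free_actM hc linear0.
- by move=> b c /asboolP hb; apply/asboolP => w; rewrite free_actM hb.
Qed.

(** The action goes through a chosen representative; [quot_act_pi] shows that the choice is
    immaterial once [V] satisfies the relations. *)
Definition quot_act (u : quot_alg R) : V -> V :=
  free_act (generic_quotient.repr (u : ring_quotient.Quotient.quot (ideal_gen R))).

Lemma quot_act_pi a v : quot_act (quot_pi R a) v = free_act a v.
Proof.
apply/eqP; rewrite -subr_eq0 -free_actBl; apply/eqP/free_act_ideal_gen.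
by apply/quot_piP; exact: generic_quotient.reprK.
Qed.

Lemma quot_act_linearl v : linear (quot_act^~ v).
Proof.
move=> c u u'; have [a ->] := quot_pi_surj u; have [b ->] := quot_pi_surj u'.
by have := free_act_linearl v c a b; rewrite -quot_piZ -raddfD /= !quot_act_pi.
Qed.

Lemma quot_act1 v : quot_act 1 v = v.
Proof. by rewrite -quot_pi1 quot_act_pi free_act1. Qed.

Lemma quot_actM u u' v : quot_act (u * u') v = quot_act u (quot_act u' v).
Proof.
have [a ->] := quot_pi_surj u; have [b ->] := quot_pi_surj u'.
by rewrite -quot_piM !quot_act_pi free_actM.
Qed.

Definition quot_representation : representation R V :=
  Representation (fun u => free_act_linear _) quot_act_linearl quot_act1 quot_actM.

Lemma quot_representation_gen i v :
  quot_representation (quot_pi R (free_gen k i)) v = f i v.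
Proof. exact: etrans (quot_act_pi _ _) (free_act_gen _ _). Qed.

End FreeAlgebraModules.

(** * Representations controlled by the generators *)

Section GeneratedRepresentations.
Variables (k : comNzRingType) (T : choiceType) (R : free_alg k T -> Prop).
Local Notation qgen i := (quot_pi R (free_gen k i)).

Lemma quot_pi_eq (a b : free_alg k T) : R (a - b) -> quot_pi R a = quot_pi R b.
Proof. by move=> Rab; apply/quot_piP; apply: mem_ideal_gen. Qed.

Section Operators.
Variables (V : lmodType k) (rho : representation R V).

HB.instance Definition _ u :=
  GRing.isLinear.Build k V V *:%R (rep_act rho u) (rep_act_linear rho u).

Lemma rep_act0l v : rho 0 v = 0.
Proof.
(* Linearity is applied to 0 = (-1) 0 + 0. *)
by rewrite -(subrr (0 : quot_alg R)) -scaleN1r addrC rep_act_linearl scaleN1r addNr.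
Qed.

Lemma rep_actZl c u v : rho (c *: u) v = c *: rho u v.
Proof. by have := rep_act_linearl rho v c u 0; rewrite /= addr0 rep_act0l addr0. Qed.

Lemma rep_actDl u u' v : rho (u + u') v = rho u v + rho u' v.
Proof. by have := rep_act_linearl rho v 1 u u'; rewrite /= !scale1r. Qed.

Lemma rep_act_piD a b v :
  rho (quot_pi R (a + b)) v = rho (quot_pi R a) v + rho (quot_pi R b) v.
Proof. by rewrite raddfD rep_actDl. Qed.

Lemma rep_act_piZ c a v : rho (quot_pi R (c *: a)) v = c *: rho (quot_pi R a) v.
Proof. by rewrite quot_piZ rep_actZl. Qed.

Lemma rep_act_piB a b v :
  rho (quot_pi R (a - b)) v = rho (quot_pi R a) v - rho (quot_pi R b) v.
Proof. by rewrite rep_act_piD -[- b]scaleN1r rep_act_piZ scaleN1r. Qed.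

Lemma rep_act_piM a b v :
  rho (quot_pi R (a * b)) v = rho (quot_pi R a) (rho (quot_pi R b) v).
Proof. by rewrite quot_piM rep_actM. Qed.

Lemma rep_act_pi1 v : rho (quot_pi R 1) v = v.
Proof. by rewrite quot_pi1 rep_act1. Qed.

Lemma rep_act_piX a n v :
  rho (quot_pi R (a ^+ n)) v = iter n (rho (quot_pi R a)) v.
Proof.
elim: n => [|n IHn]; first exact: rep_act_pi1.
by rewrite exprS rep_act_piM IHn.
Qed.

(** The elements mapping [W] into itself form a subalgebra, so it suffices that this subalgebra
    contains the generators. *)
Lemma stable_gen (W : {pred V}) : submod_closed W ->
  (forall i v, v \in W -> rho (qgen i) v \in W) -> stable rho W.
Proof.
case=> W0 Wlin Wgen u v vW; have [a ->] := quot_pi_surj u.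
elim/free_alg_ind: a => [|c a b IHa IHb||i a IHa].
- by rewrite raddf0 rep_act0l.
- by rewrite rep_act_piD rep_act_piZ; apply: Wlin.
- by rewrite rep_act_pi1.
- by rewrite rep_act_piM; apply: Wgen.
Qed.

End Operators.

Lemma intertwine_gen (V W : lmodType k) (rho : representation R V)
    (sigma : representation R W) (f : {linear V -> W}) :
  (forall i v, f (rho (qgen i) v) = sigma (qgen i) (f v)) ->
  forall u v, f (rho u v) = sigma u (f v).
Proof.
move=> fgen u v; have [a ->] := quot_pi_surj u.
elim/free_alg_ind: a v => [|c a b IHa IHb||i a IHa] v.
- by rewrite raddf0 !rep_act0l linear0.
- by rewrite !rep_act_piD !rep_act_piZ linearP IHa IHb.
- by rewrite !rep_act_pi1.
- by rewrite !rep_act_piM fgen IHa.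
Qed.

End GeneratedRepresentations.

(** * Modules over A(xi) in terms of operators h, x, y *)

Section LiftingModules.
Variables (k : closedFieldType) (Gam : finGroupType) (D : datum k Gam).
Variable xi : Gam -> k.
Local Notation Rel := (relA D xi).

Section Relations.
Variables (V : lmodType k) (rho : representation Rel V).
Local Notation H h := (rep_act rho (Ah D xi h)).
Local Notation X := (rep_act rho (Ax D xi)).
Local Notation Y := (rep_act rho (Ay D xi)).

Lemma rep_h1 v : H 1%g v = v.
Proof.
by rewrite /Ah (quot_pi_eq (rel_1 D xi)); apply: rep_act_pi1.
Qed.

Lemma rep_hM g h v : H (g * h)%g v = H g (H h v).
Proof. by rewrite /Ah (quot_pi_eq (rel_mul D xi g h)); apply: rep_act_piM. Qed.

Lemma rep_hLam g v : g \in Lam D -> H g v = xi g *: v.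
Proof.
move=> gL; rewrite /Ah (quot_pi_eq (rel_Lam xi gL)).
by apply: etrans (rep_act_piZ _ _ _ _) _; congr (_ *: _); apply: rep_act_pi1.
Qed.

Lemma rep_hx h v : H h (X v) = chi1 D h *: X (H h v).
Proof.
rewrite /Ah /Ax -rep_act_piM (quot_pi_eq (rel_hx D xi h)).
by apply: etrans (rep_act_piZ _ _ _ _) _; congr (_ *: _); apply: rep_act_piM.
Qed.

Lemma rep_hy h v : H h (Y v) = chi2 D h *: Y (H h v).
Proof.
rewrite /Ah /Ay -rep_act_piM (quot_pi_eq (rel_hy D xi h)).
by apply: etrans (rep_act_piZ _ _ _ _) _; congr (_ *: _); apply: rep_act_piM.
Qed.

Lemma rep_xr v : iter (r D) X v = alpha D xi *: v.
Proof.
rewrite /Ax -rep_act_piX (quot_pi_eq (rel_xr D xi)).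
by apply: etrans (rep_act_piZ _ _ _ _) _; congr (_ *: _); apply: rep_act_pi1.
Qed.

Lemma rep_ys v : iter (s D) Y v = beta D xi *: v.
Proof.
rewrite /Ay -rep_act_piX (quot_pi_eq (rel_ys D xi)).
by apply: etrans (rep_act_piZ _ _ _ _) _; congr (_ *: _); apply: rep_act_pi1.
Qed.

Lemma rep_xy v : X (Y v) =
  chi2 D (g1 D) *: Y (X v) + nu D *: (H (g1 D * g2 D)%g v - v).
Proof.
rewrite /Ax /Ay -rep_act_piM (quot_pi_eq (rel_xy D xi)).
apply: etrans (rep_act_piD _ _ _ _) _; congr (_ + _).
  by apply: etrans (rep_act_piZ _ _ _ _) _; congr (_ *: _); apply: rep_act_piM.
apply: etrans (rep_act_piZ _ _ _ _) _; congr (_ *: _).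
by apply: etrans (rep_act_piB _ _ _ _) _; congr (_ - _); apply: rep_act_pi1.
Qed.

End Relations.

(** The universal property of the presentation of A(xi), through which L(eta) is constructed. *)
Lemma lifting_representation (V : lmodType k)
    (H : Gam -> {linear V -> V}) (X Y : {linear V -> V}) :
  (forall v, H 1%g v = v) -> (forall g h v, H (g * h)%g v = H g (H h v)) ->
  (forall g v, g \in Lam D -> H g v = xi g *: v) ->
  (forall h v, H h (X v) = chi1 D h *: X (H h v)) ->
  (forall h v, H h (Y v) = chi2 D h *: Y (H h v)) ->
  (forall v, iter (r D) X v = alpha D xi *: v) ->
  (forall v, iter (s D) Y v = beta D xi *: v) ->
  (forall v, X (Y v) =
     chi2 D (g1 D) *: Y (X v) + nu D *: (H (g1 D * g2 D)%g v - v)) ->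
  exists rho : representation Rel V,
    [/\ forall h v, rho (Ah D xi h) v = H h v,
        forall v, rho (Ax D xi) v = X v & forall v, rho (Ay D xi) v = Y v].
Proof.
move=> H1 HM HLam HX HY Xr Ys XY.
pose f (i : gens Gam) : {linear V -> V} :=
  match i with inl h => H h | inr b => if b then X else Y end.
have fH h v : free_act f (fh k h) v = H h v by apply: (free_act_gen f (inl h)).
have fX v : free_act f (fx k Gam) v = X v by apply: (free_act_gen f (inr true)).
have fY v : free_act f (fy k Gam) v = Y v by apply: (free_act_gen f (inr false)).
have fsc c v : free_act f c%:A v = c *: v.
  by apply: etrans (free_actZl f c 1 v) _; rewrite free_act1.
have fexp a n v : free_act f (a ^+ n) v = iter n (free_act f a) v.
  elim: n v => [|n IHn] v; first exact: free_act1.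
  by rewrite exprS; apply: etrans (free_actM f _ _ v) _; rewrite IHn.
have fB a b v : free_act f a v = free_act f b v -> free_act f (a - b) v = 0.
  by move=> e; apply: etrans (free_actBl f a b v) _; rewrite e subrr.
have f_rel a : Rel a -> forall v, free_act f a v = 0.
  case=> [|g h|g gL|h|h|||] v; apply: fB.
  - by rewrite fH H1 free_act1.
  - by rewrite fH HM; apply/esym/(etrans (free_actM f _ _ v)); rewrite !fH.
  - by rewrite fH fsc HLam.
  - apply: etrans (free_actM f _ _ v) _; apply/esym.
    apply: etrans (free_actZl f _ _ v) _; rewrite fX fH HX; congr (_ *: _).
    by apply: etrans (free_actM f _ _ v) _; rewrite fX fH.
  - apply: etrans (free_actM f _ _ v) _; apply/esym.
    apply: etrans (free_actZl f _ _ v) _; rewrite fY fH HY; congr (_ *: _).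
    by apply: etrans (free_actM f _ _ v) _; rewrite fY fH.
  - by rewrite fexp fsc -Xr; apply: eq_iter.
  - by rewrite fexp fsc -Ys; apply: eq_iter.
  - apply: etrans (free_actM f _ _ v) _; rewrite fX fY XY; apply/esym.
    apply: etrans (free_actDl f _ _ v) _; congr (_ + _).
      apply: etrans (free_actZl f _ _ v) _; congr (_ *: _).
      by apply: etrans (free_actM f _ _ v) _; rewrite fX fY.
    apply: etrans (free_actZl f _ _ v) _; congr (_ *: _).
    by apply: etrans (free_actBl f _ _ v) _; rewrite fH free_act1.
exists (quot_representation f_rel); split=> [h v|v|v].
- exact: (quot_representation_gen f_rel (inl h)).
- exact: (quot_representation_gen f_rel (inr true)).
- exact: (quot_representation_gen f_rel (inr false)).
Qed.

End LiftingModules.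

(** * Iterates of a lowering operator *)

Lemma scaler_eqr (k : fieldType) (V : lmodType k) (a b : k) (w : V) :
  w != 0 -> a *: w = b *: w -> a = b.
Proof.
move=> w0 /eqP; rewrite -subr_eq0 -scalerBl scaler_eq0 (negPf w0) orbF subr_eq0.
by move/eqP.
Qed.

Section LinearOperators.
Variables (k : fieldType) (V : lmodType k).

Lemma iter_linear_sum (f : {linear V -> V}) n (I : finType) (a : I -> k) (w : I -> V) :
  iter n f (\sum_i a i *: w i) = \sum_i a i *: iter n f (w i).
Proof.
elim: n => //= n ->; rewrite linear_sum; apply: eq_bigr => i _.
exact: linearZ.
Qed.

Lemma iter_linear0 (f : {linear V -> V}) n : iter n f 0 = 0.
Proof. by elim: n => //= n ->; apply: linear0. Qed.

(** The last nonzero iterate of [u] lies in the kernel. *)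
Lemma nilpotent_ker (f : {linear V -> V}) n u :
  u != 0 -> iter n f u = 0 -> exists2 w, w != 0 & f w = 0.
Proof.
elim: n => [|n IHn] u0 /=; first by move=> u00; rewrite u00 eqxx in u0.
by case: (eqVneq (iter n f u) 0) => [/IHn-/(_ u0)//|? ?]; exists (iter n f u).
Qed.

Section Descent.
Variables (y : {linear V -> V}) (w : nat -> V) (c : nat -> k) (N : nat).
Hypothesis y0 : y (w 0%N) = 0.
Hypothesis yS : forall i, y (w i.+1) = c i.+1 *: w i.
Hypothesis w0 : w 0%N != 0.
Hypothesis cN : forall i, (0 < i < N)%N -> c i != 0.

Lemma descent_lt m i : (i < m)%N -> iter m y (w i) = 0.
Proof.
elim: m i => // m IHm [|i] lt_im; rewrite iterSr.
  by rewrite y0 iter_linear0.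
rewrite yS -[_ *: _]addr0.
(* A sum with a single term pulls the scalar out of the iterate. *)
have := iter_linear_sum y m (fun _ : 'I_1 => c i.+1) (fun _ => w i).
by rewrite !big_ord1 addr0 => ->; rewrite IHm ?scaler0.
Qed.

Lemma descent_diag m : iter m y (w m) = (\prod_(i < m) c i.+1) *: w 0%N.
Proof.
elim: m => [|m IHm]; first by rewrite big_ord0 scale1r.
rewrite iterSr yS.
have := iter_linear_sum y m (fun _ : 'I_1 => c m.+1) (fun _ => w m).
by rewrite !big_ord1 => ->; rewrite IHm scalerA big_ord_recr mulrC.
Qed.

Lemma descent (a : nat -> k) i0 : (i0 < N)%N -> a i0 != 0 ->
  exists m d, [/\ (m < N)%N, forall i, (m < i < N)%N -> a i = 0, d != 0
    & iter m y (\sum_(i < N) a i *: w i) = d *: w 0%N].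
Proof.
move=> i0N ai0; pose P i := (i < N)%N && (a i != 0).
have exP : exists i, P i by exists i0; rewrite /P i0N.
have ubP i : P i -> (i <= N)%N by case/andP=> /ltnW.
case: (ex_maxnP exP ubP) => m /andP[mN am] mmax.
have a0 i : (m < i < N)%N -> a i = 0.
  case/andP=> mi iN; apply/eqP/negbNE/negP => ai.
  by have := mmax i; rewrite /P iN ai leqNgt mi => /(_ isT).
(* Terms of index below [m] are killed by y^m and those above have zero coefficient; the term of
   index [m] yields a_m c_1 ... c_m, nonzero because [m < N]. *)
exists m, (a m * \prod_(i < m) c i.+1); split=> //.
  rewrite mulf_neq0 //; apply/prodf_neq0 => i _; apply: cN => /=.
  exact: leq_ltn_trans (ltn_ord i) mN.
rewrite iter_linear_sum (bigD1 (Ordinal mN)) //= descent_diag scalerA.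
rewrite [X in _ + X]big1 ?addr0 //.
move=> i; rewrite -val_eqE /= neq_ltn => /orP[lt_im|lt_mi].
  by rewrite descent_lt ?scaler0.
by rewrite a0 ?scale0r // lt_mi ltn_ord.
Qed.

Lemma descent_free (a : nat -> k) : \sum_(i < N) a i *: w i = 0 ->
  forall i, (i < N)%N -> a i = 0.
Proof.
move=> a0 i iN; apply/eqP/negbNE/negP => ai.
have [m [d [_ _ d0]]] := descent iN ai.
rewrite a0 iter_linear0 => /esym/eqP.
by rewrite scaler_eq0 (negPf d0) (negPf w0).
Qed.

(** For nonzero [u] in the kernel, the exponent [m] given by [descent] must be 0, and its conclusion
    is then about [u] itself. *)
Lemma descent_ker (a : nat -> k) u : u = \sum_(i < N) a i *: w i -> y u = 0 ->
  exists b, u = b *: w 0%N.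
Proof.
move=> uE yu; have [i0 ai0|a0] := pickP (fun i : 'I_N => a i != 0); last first.
  exists 0; rewrite scale0r uE big1 // => i _.
  by have /eqP-> := negbFE (a0 i); rewrite scale0r.
have [[|m] [d [_ _ d0]]] := descent (ltn_ord i0) ai0; rewrite -uE.
  by move=> /= ->; exists d.
rewrite iterSr yu iter_linear0 => /esym/eqP.
by rewrite scaler_eq0 (negPf d0) (negPf w0).
Qed.

End Descent.

End LinearOperators.

(** * Common eigenvectors of commuting operators of finite order *)

Section Eigenvectors.
Variables (k : closedFieldType) (V : lmodType k).

(** The vector p(f)(u), written as a sum of iterates since [V] may have infinite dimension. *)
Definition poly_act (f : V -> V) (p : {poly k}) (u : V) : V :=
  \sum_(i < size p) p`_i *: iter i f u.

Lemma poly_act_widen f (p : {poly k}) u n : (size p <= n)%N ->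
  poly_act f p u = \sum_(i < n) p`_i *: iter i f u.
Proof.
move=> le_pn; rewrite /poly_act -!(big_mkord xpredT (fun i => p`_i *: iter i f u)).
rewrite (big_cat_nat _ le_pn) //= [X in _ = _ + X]big_nat_cond.
rewrite [X in _ = _ + X]big1 ?addr0 //.
by move=> i /andP[/andP[le_i _] _]; rewrite nth_default ?scale0r.
Qed.

Lemma poly_act_XsubC (f : {linear V -> V}) (p : {poly k}) z u :
  poly_act f (p * ('X - z%:P)) u = f (poly_act f p u) - z *: poly_act f p u.
Proof.
have le : (size (p * ('X - z%:P))%R <= (size p).+1)%N.
  by rewrite (leq_trans (size_polyMleq _ _)) // size_XsubC addn2.
rewrite (poly_act_widen _ _ le) [X in f X]/poly_act (poly_act_widen f u (leqnSn (size p))).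
rewrite linear_sum scaler_sumr.
under eq_bigr => i _ do rewrite mulrBr coefB coefMX coefMC scalerBl mulrC -scalerA.
rewrite sumrB big_ord_recl /= scale0r add0r; congr (_ - _).
by apply: eq_bigr => i _; rewrite linearZ.
Qed.

(** Induction on the degree: write p = q (X - z). Either q(f)(u) = 0 and [q] replaces [p], or
    q(f)(u) is an eigenvector for [z]. The predicate [P] is a subspace stable under [f], so the
    eigenvector stays in it. *)
Lemma eigenvector_of_poly (f : {linear V -> V}) (P : V -> Prop) p u :
  P 0 -> (forall c a b, P a -> P b -> P (c *: a + b)) ->
  (forall a, P a -> P (f a)) ->
  P u -> u != 0 -> p != 0 -> poly_act f p u = 0 ->
  exists z w, [/\ P w, w != 0 & f w = z *: w].
Proof.
move=> P0 Plin Pf Pu u0.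
have [n] := ubnP (size p); elim: n p => // n IHn p szp p0 pu.
(* A nonzero constant cannot annihilate [u], so [p] has a root. *)
have szp1 : size p != 1%N.
  apply/eqP => sz1; move: pu p0; rewrite /poly_act sz1 big_ord1 /= => /eqP.
  rewrite scaler_eq0 (negPf u0) orbF => /eqP p00.
  by rewrite -lead_coef_eq0 lead_coefE sz1 p00 eqxx.
have [z] := closed_rootP p szp1; case/factor_theorem => q pE.
have q0 : q != 0 by apply: contraNneq p0 => q00; rewrite pE q00 mul0r.
case: (eqVneq (poly_act f q u) 0) => [qu|qu].
  apply: (IHn q) => //; move: szp.
  by rewrite pE size_Mmonic ?monicXsubC // size_XsubC addn2.
exists z, (poly_act f q u); split=> //; last first.
  by apply/eqP; rewrite -subr_eq0 -poly_act_XsubC -pE pu.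
rewrite /poly_act; elim/big_rec: _ => // i v _ Pv; apply: Plin => //.
by elim: (nat_of_ord i) => //= j; apply: Pf.
Qed.

(** Induction on the list: the joint eigenspace of the operators already treated is stable under the
    next one by commutation, and that operator is annihilated by X^n - 1. *)
Lemma commuting_eigenvector (G : eqType) (H : G -> {linear V -> V}) (P : V -> Prop) u :
  (forall g h v, H g (H h v) = H h (H g v)) ->
  (forall g, exists2 n, (0 < n)%N & forall v, iter n (H g) v = v) ->
  P 0 -> (forall c a b, P a -> P b -> P (c *: a + b)) ->
  (forall g a, P a -> P (H g a)) -> P u -> u != 0 ->
  forall l : seq G, exists e w, [/\ P w, w != 0 & {in l, forall g, H g w = e g *: w}].
Proof.
move=> Hcomm Hfin P0 Plin PH Pu u0; elim=> [|g l [e [w [Pw w0 we]]]].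
  by exists (fun=> 0), u.
pose Q v := P v /\ {in l, forall h, H h v = e h *: v}.
have [n n0 gn] := Hfin g.
have [|c a b [Pa Qa] [Pb Qb]|a [Pa Qa]||||z [w' [[Pw' Qw'] w'0 gw']]] :=
  @eigenvector_of_poly (H g) Q ('X^n - 1) w _ _ _ _ w0.
- by split=> // h _; rewrite linear0 scaler0.
- split=> [|h hl]; first exact: Plin.
  by rewrite linearP Qa // Qb // scalerDr !scalerA mulrC.
- by split=> [|h hl]; [apply: PH|rewrite Hcomm Qa // linearZ].
- by [].
- by rewrite -size_poly_eq0 size_XnsubC.
(* Only the coefficients 1 at [n] and -1 at 0 contribute, giving w - w. *)
- rewrite /poly_act size_XnsubC // big_ord_recr /= coefB coefXn coef1 eqxx.
  rewrite gn gtn_eqF // subr0 scale1r -[n](prednK n0) big_ord_recl /=.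
  rewrite coefB coefXn coef1 /= sub0r scaleN1r big1 ?addr0 ?addNr //.
  move=> i _; rewrite coefB coefXn coef1 /= /bump add1n eqSS ltn_eqF ?ltn_ord //.
  by rewrite subrr scale0r.
exists (fun h => if h == g then z else e h), w'; split=> // h.
by rewrite inE; case: eqP => [->|_ /Qw'].
Qed.

End Eigenvectors.

(** * The scalars c_i when nu = 1 *)

Section Scalars.
Variables (k : closedFieldType) (Gam : finGroupType) (D : datum k Gam).
Hypotheses (hD : lifting_datum D) (hnu : nu D = 1).
Local Notation q := (qpar D).

(** Contrapositive of [nu_eq0], as nu = 1 is nonzero. *)
Lemma chi12_eq1 h : chi1 D h * chi2 D h = 1.
Proof.
move: h; apply: contrapT => chiN1.
by have := nu_eq0 hD (or_intror chiN1); rewrite hnu => /eqP; rewrite oner_eq0.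
Qed.

Lemma qpar_chi2_g1 : q * chi2 D (g1 D) = 1.
Proof. exact: chi12_eq1. Qed.

Lemma chi2_g1_neq0 : chi2 D (g1 D) != 0.
Proof.
by apply/eqP => e; have /eqP := qpar_chi2_g1; rewrite e mulr0 eq_sym oner_eq0.
Qed.

Lemma chi1_g2 : chi1 D (g2 D) = q.
Proof.
by apply: (mulIf chi2_g1_neq0); rewrite (chi12_braid hD) qpar_chi2_g1.
Qed.

Lemma chi1_g12 : chi1 D (g1 D * g2 D)%g = q ^+ 2.
Proof. by rewrite (chi1_char hD).2 ?inE // chi1_g2 expr2. Qed.

Lemma qpar_neq1 : q != 1.
Proof.
by apply/negP; rewrite -(prim_order_dvd (r_order hD) 1) dvdn1 gtn_eqF // (r_gt1 hD).
Qed.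

(** The scalars q and chi_2(g_2) are mutually inverse, so they have the same order. *)
Lemma r_eq_s : r D = s D.
Proof.
have qc : q * chi2 D (g2 D) = 1 by rewrite -chi1_g2 chi12_eq1.
have qcX n : q ^+ n * chi2 D (g2 D) ^+ n = 1 by rewrite -exprMn qc expr1n.
apply/eqP; rewrite eqn_dvd (prim_order_dvd (r_order hD)) (prim_order_dvd (s_order hD)).
have := qcX (s D); rewrite (prim_expr_order (s_order hD)) mulr1 => ->.
by have := qcX (r D); rewrite (prim_expr_order (r_order hD)) mul1r => ->; rewrite eqxx.
Qed.

Lemma c_S eta i :
  c_ D eta i.+1 = q * (c_ D eta i - (eta (g1 D * g2 D)%g * q ^+ 2 ^+ i - 1)).
Proof. by rewrite /= chi1_g12 hnu mul1r. Qed.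

(** Keeping the factor q - 1 on the left avoids division and makes the inductive step a ring
    identity; [qpar_neq1] cancels it in [c_r_eq0]. *)
Lemma c_closed eta n :
  c_ D eta n * (q - 1) = (q ^+ n - 1) * (q - eta (g1 D * g2 D)%g * q ^+ n).
Proof.
elim: n => [|n IHn]; first by rewrite /= mul0r expr0 subrr mul0r.
rewrite c_S -exprM mulnC exprM expr2 -mulrA mulrBl {}IHn exprS.
ring.
Qed.

Lemma c_r_eq0 eta : c_ D eta (r D) = 0.
Proof.
have /eqP := c_closed eta (r D).
rewrite (prim_expr_order (r_order hD)) subrr mul0r mulf_eq0 subr_eq0.
by rewrite (negPf qpar_neq1) orbF => /eqP.
Qed.

Lemma least_zero_exists eta : exists2 N, least_zero D eta N & (N <= r D)%N.
Proof.
have r0 : (0 < r D)%N := ltnW (r_gt1 hD).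
have exN : exists n, (0 < n)%N && (c_ D eta n == 0).
  by exists (r D); rewrite r0 c_r_eq0 eqxx.
case: (ex_minnP exN) => N /andP[N0 /eqP cN] Nmin.
exists N; last by apply: Nmin; rewrite r0 c_r_eq0 eqxx.
split=> // m /andP[m0 ltmN] /eqP cm.
by have := Nmin m; rewrite m0 cm leqNgt ltmN => /(_ isT).
Qed.

End Scalars.

(** * Linear maps prescribed on a basis *)

Section Bases.
Variables (k : fieldType) (N : nat) (L : vectType k) (v : N.-tuple L).
Hypothesis v_basis : basis_of fullv v.

Lemma basis_sum u : u = \sum_(i < N) coord v i u *: v`_i.
Proof. exact: coord_basis v_basis (memvf u). Qed.

Lemma basis_linear_ext (W : lmodType k) (f g : {linear L -> W}) :
  (forall i, f v`_i = g v`_i) -> f =1 g.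
Proof.
move=> fg u; rewrite [u]basis_sum !linear_sum; apply: eq_bigr => i _.
by rewrite !linearZ fg.
Qed.

(** The vanishing of [w] beyond [N] matches the default value 0 of the basis tuple, so the equations
    hold at every natural index. *)
Lemma basis_linear_exists (W : lmodType k) (w : nat -> W) :
  (forall i, (N <= i)%N -> w i = 0) ->
  exists f : {linear L -> W}, forall i, f v`_i = w i.
Proof.
move=> wN; pose f u : W := \sum_(i < N) coord v i u *: w i.
have flin : linear f.
  move=> c a b; rewrite /f scaler_sumr -big_split; apply: eq_bigr => i _.
  by rewrite linearP scalerDl scalerA.
pose F : {linear L -> W} := HB.pack f (GRing.isLinear.Build _ _ _ _ f flin).
exists F => i; rewrite /F /= /f.
have [iN|leNi] := ltnP i N; last first.
  rewrite wN // nth_default ?size_tuple // big1 // => j _.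
  by rewrite linear0 scale0r.
rewrite (bigD1 (Ordinal iN)) //= (coord_free (Ordinal iN)) ?(basis_free v_basis) //.
rewrite eqxx scale1r big1 ?addr0 // => j ji.
by rewrite (coord_free (Ordinal iN)) ?(basis_free v_basis) // eq_sym (negPf ji) scale0r.
Qed.

End Bases.

Lemma row_basis (k : fieldType) (N : nat) :
  exists v : N.-tuple 'rV[k]_N, basis_of fullv v.
Proof.
have e : \dim (fullv : {vspace 'rV[k]_N}) = N by rewrite dimvf /dim /= mul1n.
by exists (tcast e (vbasis fullv)); rewrite val_tcast; apply: vbasisP.
Qed.

(** * Chains of weight vectors in an A(xi)-module *)

Section WeightChains.
Variables (k : closedFieldType) (Gam : finGroupType) (D : datum k Gam).
Variable xi : Gam -> k.
Hypothesis halpha : alpha D xi = 0.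
Local Notation Rel := (relA D xi).

(* At i = 0 the junk value w 0.-1 = w 0 is harmless since c_0 = 0. *)
Definition weight_chain (V : lmodType k) (rho : representation Rel V)
    (eta : Gam -> k) (w : nat -> V) : Prop :=
  forall i, [/\ forall h, rho (Ah D xi h) (w i) = (eta h * chi1 D h ^+ i) *: w i,
    rho (Ay D xi) (w i) = c_ D eta i *: w i.-1
    & rho (Ax D xi) (w i) = w i.+1].

Lemma stable_lifting (V : lmodType k) (rho : representation Rel V) (W : {pred V}) :
  submod_closed W ->
  (forall h v, v \in W -> rho (Ah D xi h) v \in W) ->
  (forall v, v \in W -> rho (Ax D xi) v \in W) ->
  (forall v, v \in W -> rho (Ay D xi) v \in W) ->
  stable rho W.
Proof.
move=> Wsub Wh Wx Wy; apply: stable_gen => // -[h|[]].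
- exact: Wh.
- exact: Wx.
- exact: Wy.
Qed.

Lemma intertwine_lifting (V W : lmodType k) (rho : representation Rel V)
    (sigma : representation Rel W) (f : {linear V -> W}) :
  (forall h v, f (rho (Ah D xi h) v) = sigma (Ah D xi h) (f v)) ->
  (forall v, f (rho (Ax D xi) v) = sigma (Ax D xi) (f v)) ->
  (forall v, f (rho (Ay D xi) v) = sigma (Ay D xi) (f v)) ->
  forall u v, f (rho u v) = sigma u (f v).
Proof.
by move=> fh fx fy; apply: intertwine_gen => -[h|[]]; [apply: fh|apply: fx|apply: fy].
Qed.

(** Beyond [N] all vectors are 0; the only delicate equation is y v_N = c_N v_{N-1}, whose right
    side vanishes because c_N = 0. *)
Lemma L_action_chain eta (N : nat) (L : vectType k) (v : N.-tuple L)
    (rho : representation Rel L) :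
  c_ D eta N = 0 -> L_action eta v rho -> weight_chain rho eta (nth 0 v).
Proof.
move=> cN act i; have [iN|leNi] := ltnP i N.
  have [ih iy ix] := act i iN; split=> //.
  by rewrite iy; case: i {iN ih iy ix} => //=; rewrite !scale0r.
have vi0 : v`_i = 0 by rewrite nth_default ?size_tuple.
have viS0 : v`_i.+1 = 0 by rewrite nth_default ?size_tuple // leqW.
rewrite vi0 viS0; split=> [h||]; rewrite linear0 ?scaler0 //.
move: leNi; rewrite leq_eqVlt => /orP[/eqP <-|ltNi]; first by rewrite cN scale0r.
by rewrite (nth_default 0) ?scaler0 // size_tuple -ltnS (ltn_predK ltNi).
Qed.

Section ChainInModule.
Variables (V : lmodType k) (rho : representation Rel V) (eta : Gam -> k).
Variables (w : nat -> V) (N : nat).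
Hypothesis wchain : weight_chain rho eta w.
Hypothesis w0 : w 0%N != 0.
Hypothesis hN : least_zero D eta N.

Let y0 : rho (Ay D xi) (w 0%N) = 0.
Proof. by case: (wchain 0) => _ -> _; rewrite scale0r. Qed.

Let yS i : rho (Ay D xi) (w i.+1) = c_ D eta i.+1 *: w i.
Proof. by case: (wchain i.+1). Qed.

Let cN i : (0 < i < N)%N -> c_ D eta i != 0.
Proof. by case: hN => _ _ h /h/eqP. Qed.

Lemma chain_iter_x i j : iter j (rho (Ax D xi)) (w i) = w (i + j)%N.
Proof.
by elim: j => [|j IHj]; rewrite ?addn0 // iterS IHj addnS; case: (wchain (i + j)%N).
Qed.

Lemma chain_free (a : nat -> k) : \sum_(i < N) a i *: w i = 0 ->
  forall i, (i < N)%N -> a i = 0.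
Proof. exact: (@descent_free _ _ (rep_act rho (Ay D xi)) _ _ _ y0 yS w0 cN). Qed.

Lemma chain_ker (a : nat -> k) u : u = \sum_(i < N) a i *: w i ->
  rho (Ay D xi) u = 0 -> exists b, u = b *: w 0%N.
Proof. exact: (@descent_ker _ _ (rep_act rho (Ay D xi)) _ _ _ y0 yS w0 cN). Qed.

(** A nonzero submodule contains w_0 by [descent], and powers of x then recover every w_i. *)
Lemma chain_irreducible :
  (forall u, exists a : nat -> k, u = \sum_(i < N) a i *: w i) -> irreducible rho.
Proof.
move=> gen; split=> [|W Wsub Wst]; first by exists (w 0%N); apply/eqP.
have [[u [uW u0]]|W0] := pselect (exists u, u \in W /\ u != 0); last first.
  by left=> v vW; apply/eqP/negbNE/negP => v0; apply: W0; exists v.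
right; have [WZ Wlin] := Wsub.
have [a uE] := gen u.
have [i0 ai0|a0] := pickP (fun i : 'I_N => a i != 0); last first.
  move: u0; rewrite uE big1 ?eqxx // => i _.
  by have /eqP-> := negbFE (a0 i); rewrite scale0r.
have [m [d [_ _ d0 ym]]] :=
  @descent _ _ (rep_act rho (Ay D xi)) w _ _ y0 yS cN a _ (ltn_ord i0) ai0.
have w0W : w 0%N \in W.
  have -> : w 0%N = d^-1 *: iter m (rho (Ay D xi)) u + 0.
    by rewrite uE ym scalerA mulVf // scale1r addr0.
  by apply: Wlin => //; elim: m {ym} => //= m; apply: Wst.
have wW i : w i \in W.
  by rewrite -[i]add0n -chain_iter_x; elim: i => //= i; apply: Wst.
move=> v; have [b ->] := gen v; elim/big_rec: _ => // i x _ xW.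
exact: Wlin.
Qed.

(** Here x^r acts as alpha = 0. *)
Lemma chain_nilpotent i : (r D <= i)%N -> w i = 0.
Proof.
move=> le_ri; rewrite -(subnK le_ri) -chain_iter_x.
by have := rep_xr rho (w (i - r D)); rewrite halpha scale0r.
Qed.

(** The span of all w_i with i >= n: by [chain_nilpotent], [r D] consecutive vectors suffice. *)
Definition chain_span (n : nat) : {pred V} :=
  fun u => `[< exists a : nat -> k, u = \sum_(i < r D) a i *: w (n + i)%N >].

Lemma chain_span_submod n : submod_closed (chain_span n).
Proof.
split=> [|c a b /asboolP[a' ->] /asboolP[b' ->]]; apply/asboolP.
  by exists (fun=> 0); rewrite big1 // => i _; rewrite scale0r.
exists (fun i => c * a' i + b' i); rewrite scaler_sumr -big_split.
by apply: eq_bigr => i _; rewrite scalerDl scalerA.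
Qed.

Lemma mem_chain_span n i : w (n + i)%N \in chain_span n.
Proof.
apply/asboolP; have [ltir|leri] := ltnP i (r D).
  exists (fun j => (j == i)%:R); rewrite (bigD1 (Ordinal ltir)) //= eqxx scale1r.
  rewrite big1 ?addr0 // => j; rewrite -val_eqE /= => /negPf->.
  by rewrite scale0r.
exists (fun=> 0); rewrite chain_nilpotent ?(leq_trans leri) ?leq_addl //.
by rewrite big1 // => j _; rewrite scale0r.
Qed.

(** Only y lowers the index, and it could leave the span only at w_n, where its coefficient is c_n =
    0. *)
Lemma chain_span_stable n : c_ D eta n = 0 -> stable rho (chain_span n).
Proof.
move=> cn0; have [s0 slin] := chain_span_submod n.
have ext (f : {linear V -> V}) :
    (forall i, f (w (n + i)%N) \in chain_span n) ->
    forall u, u \in chain_span n -> f u \in chain_span n.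
  move=> fw u /asboolP[a ->]; rewrite linear_sum; elim/big_rec: _ => // i x _ xs.
  by rewrite linearZ; apply: slin.
apply: stable_lifting => [|h v|v|v]; first exact: chain_span_submod.
- apply: (ext (rep_act rho (Ah D xi h))) => i.
  case: (wchain (n + i)%N) => /= -> _ _; rewrite -[_ *: _]addr0.
  by apply: slin => //; apply: mem_chain_span.
- apply: (ext (rep_act rho (Ax D xi))) => i.
  by case: (wchain (n + i)%N) => /= _ _ ->; rewrite -addnS mem_chain_span.
- apply: (ext (rep_act rho (Ay D xi))) => -[|i].
    by case: (wchain (n + 0)%N) => /= _ -> _; rewrite addn0 cn0 scale0r.
  rewrite addnS; case: (wchain (n + i).+1) => /= _ -> _; rewrite -[_ *: _]addr0.
  by apply: slin => //; apply: mem_chain_span.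
Qed.

(* If the submodule spanned by the w_i with i >= N were the whole of V, then
   w_0 would be a combination of such w_i, and applying powers of x would give
   w_j = 0 for all j by descending induction. *)
Lemma irreducible_chain_end : irreducible rho -> forall i, (N <= i)%N -> w i = 0.
Proof.
case: hN => N0 cN0 _ [_ /(_ _ (chain_span_submod N) (chain_span_stable cN0))].
case=> [s0|sT] i leNi.
  by apply: s0; rewrite -(subnKC leNi) mem_chain_span.
have /asboolP[a w0E] := sT (w 0%N).
suff wj j : w j = 0 by [].
have [n] := ubnP (r D - j); elim: n j => // n IHn j ltn.
have [lerj|ltjr] := leqP (r D) j; first exact: chain_nilpotent.
rewrite -[j]add0n -chain_iter_x w0E.
rewrite (iter_linear_sum (rep_act rho (Ax D xi))) big1 // => m _.
rewrite chain_iter_x IHn ?scaler0 //; lia.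
Qed.

(** The span of the whole chain is a submodule since c_0 = 0, and it contains w_0, so it is all of
    [V]; the terms with i >= N vanish by [irreducible_chain_end]. *)
Lemma irreducible_chain_gen : irreducible rho ->
  forall u, exists a : nat -> k, u = \sum_(i < N) a i *: w i.
Proof.
move=> irr u; case: (irr) => _.
have c0 : c_ D eta 0 = 0 by [].
move=> /(_ _ (chain_span_submod 0) (chain_span_stable c0)) [s0|/(_ u)/asboolP[a ->]].
  by move: w0; rewrite (s0 (w 0%N)) ?eqxx // -[X in w X]add0n mem_chain_span.
exists (fun i => if (i < r D)%N then a i else 0).
under [LHS]eq_bigr => i _ do rewrite add0n.
(* Both sums are padded with zero terms to a common length. *)
pose m := maxn N (r D).
transitivity (\sum_(i < m) (if (i < r D)%N then a i else 0) *: w i).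
  rewrite (big_ord_widen m (fun i => a i *: w i)) ?leq_maxr // big_mkcond.
  by apply: eq_bigr => i _; case: ifP => // _; rewrite scale0r.
rewrite [RHS](big_ord_widen m
  (fun i => (if (i < r D)%N then a i else 0) *: w i)) ?leq_maxl //.
rewrite [RHS]big_mkcond; apply: eq_bigr => i _; case: (ltnP i N) => // leNi.
by rewrite (irreducible_chain_end irr leNi) scaler0.
Qed.

End ChainInModule.

End WeightChains.

(** * Construction of L(eta) and classification of the irreducible modules *)

Section SimpleModules.
Variables (k : closedFieldType) (Gam : finGroupType) (D : datum k Gam).
Variable xi : Gam -> k.
Hypotheses (abGam : abelian [set: Gam]).
Hypotheses (hD : lifting_datum D) (hnu : nu D = 1).
Hypotheses (halpha : alpha D xi = 0) (hbeta : beta D xi = 0).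
Local Notation Rel := (relA D xi).

(** The operators are prescribed on the basis, and each defining relation is checked on basis
    vectors. *)
Lemma L_action_exists eta (N : nat) (L : vectType k) (v : N.-tuple L) :
  inF D xi eta -> least_zero D eta N -> basis_of fullv v ->
  exists rho : representation Rel L, L_action eta v rho.
Proof.
move=> [[eta1 etaM] etaL] hN vb; have [N0 cN0 _] := hN.
have leNr : (N <= r D)%N.
  have [_ _ cN] := hN; rewrite leqNgt; apply/negP => ltrN.
  by apply: (cN (r D)); rewrite ?c_r_eq0 // (ltnW (r_gt1 hD)).
have vN i : (N <= i)%N -> v`_i = 0 by move=> le; rewrite nth_default ?size_tuple.
have /choice[H HE] h : exists f : {linear L -> L},
    forall i, f v`_i = (eta h * chi1 D h ^+ i) *: v`_i.
  by apply: (basis_linear_exists vb) => i /vN->; rewrite scaler0.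
have [X XE] : exists f : {linear L -> L}, forall i, f v`_i = v`_i.+1.
  by apply: (basis_linear_exists vb) => i le; rewrite vN // leqW.
have [Y YE] : exists f : {linear L -> L}, forall i, f v`_i = c_ D eta i *: v`_i.-1.
  (* At index [N] the prescribed image is c_N v_{N-1}, which is 0 only thanks to c_N = 0. *)
  apply: (basis_linear_exists vb) => i; rewrite leq_eqVlt => /orP[/eqP<-|ltNi].
    by rewrite cN0 scale0r.
  by rewrite vN ?scaler0 // -ltnS (ltn_predK ltNi).
have iterX n i : iter n X v`_i = v`_(i + n).
  by elim: n => [|n IHn]; rewrite ?addn0 // iterS IHn XE addnS.
have iterY n i : (i < n)%N -> iter n Y v`_i = 0.
  apply: (@descent_lt _ _ Y (nth 0 v) (c_ D eta)); first by rewrite YE scale0r.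
  by move=> j; rewrite YE.
have [rho [rhoH rhoX rhoY]] : exists rho : representation Rel L,
    [/\ forall h u, rho (Ah D xi h) u = H h u,
        forall u, rho (Ax D xi) u = X u & forall u, rho (Ay D xi) u = Y u].
  apply: lifting_representation.
  - apply: (basis_linear_ext vb (f := H 1%g) (g := idfun)) => i /=.
    by rewrite HE eta1 (chi1_char hD).1 expr1n mulr1 scale1r.
  - move=> g h; apply: (basis_linear_ext vb (f := H (g * h)%g) (g := H g \o H h)) => i /=.
    rewrite !HE linearZ /= HE scalerA etaM ?inE // (chi1_char hD).2 ?inE // exprMn.
    by congr (_ *: _); ring.
  - move=> g + gL; apply: (basis_linear_ext vb (f := H g) (g := xi g \*: idfun)) => i /=.
    by rewrite HE etaL //; move: gL; rewrite inE => /andP[/eqP-> _]; rewrite expr1n mulr1.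
  - move=> h; apply: (basis_linear_ext vb (f := H h \o X)
      (g := chi1 D h \*: (X \o H h))) => i /=.
    by rewrite HE XE linearZ /= XE HE scalerA exprS; congr (_ *: _); ring.
  - move=> h; apply: (basis_linear_ext vb (f := H h \o Y)
      (g := chi2 D h \*: (Y \o H h))) => i /=.
    rewrite HE YE !linearZ /= YE HE !scalerA; case: i => [|i] /=.
      by rewrite !(mul0r, mulr0) !scale0r.
    congr (_ *: _); have chi12 := chi12_eq1 hD hnu h.
    (* Lowering the index removes one factor chi_1(h), which chi_2(h) compensates. *)
    rewrite exprS -[LHS]mul1r -chi12; ring.
  - move=> u; rewrite halpha scale0r [u](basis_sum vb) iter_linear_sum big1 // => i _.
    by rewrite iterX vN ?scaler0 // (leq_trans leNr) // leq_addl.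
  (* Since N <= r = s, the power y^s lowers every v_i past v_0. *)
  - move=> u; rewrite hbeta scale0r [u](basis_sum vb) iter_linear_sum big1 // => i _.
    by rewrite iterY ?scaler0 // -(r_eq_s hD hnu) (leq_trans (ltn_ord i)).
  (* On v_i the relation reads c_i = q^-1 c_{i+1} + (eta(g_1 g_2) q^(2i) - 1), the recursion for c.
     At i = 0 the junk predecessor is multiplied by c_0 = 0. *)
  - apply: (basis_linear_ext vb (f := X \o Y)
      (g := chi2 D (g1 D) \*: (Y \o X) \+ nu D \*: (H (g1 D * g2 D)%g \- idfun))) => i /=.
    rewrite XE !YE HE hnu scale1r (chi1_g12 hD hnu) c_S // linearZ /= XE.
    rewrite scalerA mulrA [chi2 _ _ * _]mulrC (qpar_chi2_g1 hD hnu) mul1r.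
    rewrite -[X in _ - X]scale1r -scalerBl -scalerDl subrK.
    by case: i => [|i] //=; rewrite !scale0r.
exists rho => i iN; split=> [h||]; rewrite ?rhoH ?rhoX ?rhoY //.
by rewrite YE; case: i {iN} => //=; rewrite !scale0r.
Qed.

Lemma is_L_chain eta (N : nat) (L : vectType k) (v : N.-tuple L)
    (rho : representation Rel L) : is_L eta v rho ->
  [/\ weight_chain rho eta (nth 0 v), v`_0 != 0 &
      forall u, exists a : nat -> k, u = \sum_(i < N) a i *: v`_i].
Proof.
case=> [[N0 cN0 _] vb act]; split; first exact: L_action_chain act.
  apply/eqP => v00; have /freeP vfree := basis_free vb.
  suff /vfree/(_ (Ordinal N0))/eqP : \sum_(i < N) (val i == 0)%:R *: v`_i = 0.
    by rewrite oner_eq0.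
  by rewrite big1 // => -[[|i] /= _] _; rewrite ?v00 ?scaler0 ?scale0r.
move=> u; exists (fun i => if insub i is Some j then coord v j u else 0).
by rewrite [LHS](basis_sum vb); apply: eq_bigr => i _; rewrite valK.
Qed.

Lemma is_L_irreducible eta (N : nat) (L : vectType k) (v : N.-tuple L)
    (rho : representation Rel L) : is_L eta v rho -> irreducible rho.
Proof.
move=> vL; have [hN _ _] := vL; have [ch v0 gen] := is_L_chain vL.
exact: chain_irreducible ch v0 hN gen.
Qed.

(** The isomorphism sends v_0 into the kernel of y, the line of v'_0; comparing the actions of h on
    this image equates the characters. *)
Lemma is_L_isomorphic_eta eta eta' N N' (L L' : vectType k)
    (v : N.-tuple L) (v' : N'.-tuple L')
    (rho : representation Rel L) (rho' : representation Rel L') :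
  is_L eta v rho -> is_L eta' v' rho' -> isomorphic rho rho' -> eta =1 eta'.
Proof.
move=> vL vL' [f fbij frho] h.
have [ch v0 _] := is_L_chain vL; have [ch' v'0 gen'] := is_L_chain vL'.
have [hN' _ _] := vL'; have [vh vy _] := ch 0%N; have [v'h _ _] := ch' 0%N.
have fv0 : f v`_0 != 0.
  by apply: contra_neq v0 => f0; apply: (bij_inj fbij); rewrite f0 linear0.
have [a aE] := gen' (f v`_0).
have [|b bE] := chain_ker ch' v'0 hN' aE; first by rewrite -frho vy scale0r linear0.
apply: (scaler_eqr fv0).
have := congr1 f (vh h); rewrite expr0 mulr1 linearZ frho => <-.
by rewrite bE linearZ /= v'h expr0 mulr1 !scalerA mulrC.
Qed.

Section Irreducible.
Variables (V : lmodType k) (rho : representation Rel V).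

(** The eigenvalues form a character agreeing with [xi] on [Lam D]: each relation among the h,
    applied to the nonzero [w], yields the scalar identity. *)
Lemma highest_weight_vector : irreducible rho ->
  exists eta w, [/\ inF D xi eta, w != 0, rho (Ay D xi) w = 0
    & forall h, rho (Ah D xi h) w = eta h *: w].
Proof.
case=> [[v /eqP v0] _].
have [u u0 yu] : exists2 u, u != 0 & rho (Ay D xi) u = 0.
  apply: (@nilpotent_ker _ _ (rep_act rho (Ay D xi)) (s D) v v0).
  by have := rep_ys rho v; rewrite hbeta scale0r.
have [|||||eta [w [yw w0 wE]]] :=
  @commuting_eigenvector k V Gam (fun h => rep_act rho (Ah D xi h))
    (fun u => rho (Ay D xi) u = 0) u _ _ _ _ _ yu u0 (enum Gam).
- move=> g h a /=; have gh := centsP abGam g (in_setT _) h (in_setT _).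
  by rewrite -!rep_hM gh.
- move=> g; exists #[g]%g; rewrite ?order_gt0 // => a /=.
  have -> n : iter n (rho (Ah D xi g)) a = rho (Ah D xi (g ^+ n)%g) a.
    by elim: n => [|n IHn]; [rewrite expg0 rep_h1 | rewrite iterS IHn expgS rep_hM].
  by rewrite expg_order rep_h1.
- exact: linear0.
- by move=> c a b ya yb; rewrite linearP /= ya yb scaler0 addr0.
(* The scalar chi_2(g) can be cancelled from chi_2(g) y g a = 0 since chi_1(g) chi_2(g) = 1. *)
- move=> g a ya; have := rep_hy rho g a; rewrite ya linear0 => /esym/eqP.
  rewrite scaler_eq0 => /orP[/eqP chi0|/eqP//].
  by have /eqP := chi12_eq1 hD hnu g; rewrite chi0 mulr0 eq_sym oner_eq0.
exists eta, w; have wh h : rho (Ah D xi h) w = eta h *: w by rewrite wE ?mem_enum.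
split=> //; split; first split.
- by apply: (scaler_eqr w0); rewrite -wh rep_h1 scale1r.
- move=> g h _ _; apply: (scaler_eqr w0).
  by rewrite -wh rep_hM wh linearZ /= wh scalerA mulrC.
- by move=> g gL; apply: (scaler_eqr w0); rewrite -wh rep_hLam.
Qed.

(** By induction x y w_i = c_i w_i; solving the relation between x and y for y x w_i then reproduces
    the recursion for c_{i+1}. *)
Lemma highest_weight_chain eta w :
  inF D xi eta -> rho (Ay D xi) w = 0 ->
  (forall h, rho (Ah D xi h) w = eta h *: w) ->
  weight_chain rho eta (fun i => iter i (rho (Ax D xi)) w).
Proof.
move=> etaF yw wh; elim=> [|i [IHh IHy _]].
  by split=> [h||] //=; rewrite ?wh ?mulr1 ?yw ?scale0r.
split=> //= [h|].
  by rewrite rep_hx IHh linearZ scalerA exprS; congr (_ *: _); ring.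
set wi := iter i _ w in IHh IHy *.
have XY : rho (Ax D xi) (rho (Ay D xi) wi) = c_ D eta i *: wi.
  (* At i = 0 both sides vanish because c_0 = 0. *)
  by rewrite IHy linearZ /wi; case: (i) => //=; rewrite !scale0r.
have -> : rho (Ay D xi) (rho (Ax D xi) wi) =
    qpar D *: (rho (Ax D xi) (rho (Ay D xi) wi) -
               (rho (Ah D xi (g1 D * g2 D)%g) wi - wi)).
  by rewrite rep_xy hnu scale1r addrK scalerA (qpar_chi2_g1 hD hnu) scale1r.
rewrite XY IHh hnu mul1r.
by rewrite -[X in _ - (_ - X)]scale1r -!scalerBl scalerA.
Qed.

(** The map [g] from L(eta) sending v_i to w_i is well behaved because w_i = 0 for i >= N. It is
    injective by [chain_free], surjective by [irreducible_chain_gen], and intertwines the actions on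
    the basis; the isomorphism sought is its inverse. *)
Lemma irreducible_is_L : irreducible rho ->
  exists2 eta, inF D xi eta &
  exists N (L : vectType k) (v : N.-tuple L) (sigma : representation Rel L),
    is_L eta v sigma /\ isomorphic rho sigma.
Proof.
move=> irr; have [eta [w0 [etaF w0N0 yw0 w0h]]] := highest_weight_vector irr.
exists eta => //; have [N hN _] := least_zero_exists hD hnu eta.
have := highest_weight_chain etaF yw0 w0h.
set w := fun i => _; have w00 : w 0%N != 0 by []; move=> ch.
have [v vb] := row_basis k N; exists N, _, v.
have [sigma sact] := L_action_exists etaF hN vb; exists sigma.
have vL : is_L eta v sigma by [].
split=> //; have [vch v0 _] := is_L_chain vL.
have wN : forall i, (N <= i)%N -> w i = 0 := irreducible_chain_end halpha ch w00 hN irr.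
have [g gv] := basis_linear_exists vb wN.
have ginj : injective g.
  apply: raddf_inj => u gu0; rewrite [u](basis_sum vb) big1 // => i _.
  have [a aE] : exists a : nat -> k, forall i : 'I_N, a i = coord v i u.
    exists (fun i => if insub i is Some j then coord v j u else 0) => j.
    by rewrite valK.
  have gu : g u = \sum_(j < N) a j *: w j.
    rewrite [in LHS](basis_sum vb u) linear_sum; apply: eq_bigr => j _.
    by rewrite linearZ /= aE gv.
  by rewrite -aE (chain_free ch w00 hN (a := a)) ?scale0r // -gu.
have /choice[f gf] : forall y, exists x, g x = y.
  move=> y; have [a ->] := irreducible_chain_gen halpha ch w00 hN irr y.
  exists (\sum_(i < N) a i *: v`_i); rewrite linear_sum; apply: eq_bigr => i _.
  by rewrite linearZ /= gv.
have fg : cancel g f by move=> u; apply: ginj; rewrite gf.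
pose F : {linear V -> 'rV[k]_N} :=
  HB.pack f (GRing.isLinear.Build _ _ _ _ f (can2_linear fg gf)).
have gint : forall u x, g (sigma u x) = rho u (g x).
  have gext a : (forall i, g (sigma a v`_i) = rho a (w i)) ->
      forall x, g (sigma a x) = rho a (g x).
    move=> ga; apply: (basis_linear_ext vb (f := g \o rep_act sigma a)
      (g := rep_act rho a \o g)) => i.
    by rewrite /= gv ga.
  apply: intertwine_lifting => [h||]; apply: gext => i; have [ih iy ix] := ch i.
  - by have [-> _ _] := vch i; rewrite ih linearZ /= gv.
  - by have [_ _ ->] := vch i; rewrite ix gv.
  - by have [_ -> _] := vch i; rewrite iy linearZ /= gv.
exists F => [|u x] /=; first by exists g.
by apply: ginj; rewrite gint !gf.
Qed.
End Irreducible.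

End SimpleModules.

Theorem theorem3p5 (k : closedFieldType) (char0 : [pchar k] =i pred0)
  (Gam : finGroupType) (abGam : abelian [set: Gam])
  (D : datum k Gam) (hD : lifting_datum D)
  (xi : Gam -> k) (hxi : is_character (Lam D) xi)
  (halpha : alpha D xi = 0) (hbeta : beta D xi = 0) (hnu : nu D = 1) :
  [/\ (forall h, chi1 D h * chi2 D h = 1) /\ r D = s D,
      (forall eta, inF D xi eta ->
        (forall i, c_ D eta i.+1 =
           qpar D * (c_ D eta i + nu D
             - nu D * qpar D ^+ (2 * i) * eta (g1 D * g2 D)%g)) /\
        (exists2 N, least_zero D eta N & (N <= r D)%N)),
      (forall eta, inF D xi eta ->
        (forall N (L : vectType k) (v : N.-tuple L),
           least_zero D eta N -> basis_of fullv v ->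
           exists rho : representation (relA D xi) L, L_action eta v rho) /\
        (forall N (L : vectType k) (v : N.-tuple L)
           (rho : representation (relA D xi) L),
           is_L eta v rho -> irreducible rho)),
      (forall (V : lmodType k) (rhoV : representation (relA D xi) V),
         irreducible rhoV ->
         exists2 eta, inF D xi eta &
         exists N (L : vectType k) (v : N.-tuple L)
           (rho : representation (relA D xi) L),
           is_L eta v rho /\ isomorphic rhoV rho)
    & (forall eta eta' N N' (L L' : vectType k)
         (v : N.-tuple L) (v' : N'.-tuple L')
         (rho : representation (relA D xi) L)
         (rho' : representation (relA D xi) L'),
         inF D xi eta -> inF D xi eta' ->
         is_L eta v rho -> is_L eta' v' rho' ->
         isomorphic rho rho' -> eta =1 eta')].
Proof.
split.
- by split; [exact: chi12_eq1|exact: r_eq_s].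
- move=> eta etaF; split; last exact: least_zero_exists.
  by move=> i; rewrite c_S // hnu exprM; ring.
- move=> eta etaF; split=> [N L v hN vb|N L v rho]; first exact: L_action_exists.
  exact: is_L_irreducible.
- by move=> V rhoV; apply: irreducible_is_L.
- by move=> eta eta' N N' L L' v v' rho rho' _ _; apply: is_L_isomorphic_eta.
Qed.
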